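(* Let $\mathcal{H}_1$ and $\mathcal{H}_2$ be two real Hilbert spaces, let $B_1:\mathcal{H}_1\to 2^{\mathcal{H}_1}$ and $F_1:\mathcal{H}_2\to 2^{\mathcal{H}_2}$ be two set-valued maximal monotone mappings, and let $A:\mathcal{H}_1\to\mathcal{H}_2$ be a bounded linear operator with adjoint $A^*$. Put $L=\|A^*A\|$ and $$\Gamma:=\{x\in\mathcal{H}_1 \mid 0\in B_1(x)\ \text{and}\ 0\in F_1(A(x))\}.$$ Let $\lambda>0$. If $\Gamma\neq\emptyset$ and $\gamma\in(0,2/L)$, then for every starting point $x^0\in\mathcal{H}_1$ the sequence $\{x^k\}_{k=0}^\infty$ generated by $$x^{k+1}=J_\lambda^{B_1}\left(x^k-\gamma A^*(I-J_\lambda^{F_1})A(x^k)\right),\qquad k\ge 0,$$ converges weakly to a point $x^*\in\Gamma$.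
   Context: A set-valued mapping $B:\mathcal{H}\to 2^{\mathcal{H}}$ on a real Hilbert space $\mathcal{H}$ is monotone if $\langle u-v,x-y\rangle\ge 0$ for all $u\in B(x)$ and $v\in B(y)$; it is maximal monotone if it is monotone and its graph $G(B)=\{(x,u)\in\mathcal{H}\times\mathcal{H}\mid u\in B(x)\}$ is not properly contained in the graph of any other monotone mapping. For $\lambda>0$ the resolvent of $B$ is $J_\lambda^B:=(I+\lambda B)^{-1}$, where $I$ is the identity operator; it is well known that for maximal monotone $B$ it is single-valued and defined on all of $\mathcal{H}$. *)

(* Defs.v *)
From HB Require Import structures.
From mathcomp Require Import all_boot all_order all_algebra.
From mathcomp Require Import all_classical all_reals all_analysis.

Set Implicit Arguments.
Unset Strict Implicit.
Unset Printing Implicit Defensive.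

Import Order.TTheory GRing.Theory Num.Theory.
Import numFieldNormedType.Exports.

Local Open Scope classical_set_scope.
Local Open Scope ring_scope.

(* Over a real field, a positive definite symmetric bilinear form is
   [{dot H for idfun}]; the complete norm is required to be the one it
   induces. *)
HB.mixin Record CompleteNormedModule_isHilbert (R : realType) H
    of CompleteNormedModule R H := {
  inner : {dot H for idfun} ;
  norm_inner : forall x : H, `|x| ^+ 2 = inner x x
}.

#[short(type="hilbertType")]
HB.structure Definition Hilbert (R : realType) :=
  {H of CompleteNormedModule R H & CompleteNormedModule_isHilbert R H}.

Notation "<| x , y |>" := (inner x y)
  (at level 0, x at level 69, y at level 69, format "<| x ,  y |>") :
  ring_scope.

(* A set-valued mapping B : H -> 2^H is a function [B : H -> set H]. *)

Definition monotone_map (R : realType) (H : hilbertType R) (B : H -> set H) :=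
  forall x y u v : H, B x u -> B y v -> 0 <= <| u - v, x - y |>.

Definition set_graph (R : realType) (H : hilbertType R) (B : H -> set H) :
  set (H * H) := [set p | B p.1 p.2].

Definition maximal_monotone (R : realType) (H : hilbertType R)
    (B : H -> set H) :=
  monotone_map B /\
  forall C : H -> set H, monotone_map C -> ~ (set_graph B `<` set_graph C).

Definition resolvent_set (R : realType) (H : hilbertType R) (lambda : R)
    (B : H -> set H) (x : H) : set H :=
  [set z | exists2 u, B z u & x = z + lambda *: u].

(* For a maximal monotone [B] and [0 < lambda], [resolvent_set lambda B x] is
   a singleton and [resolvent lambda B x] is its element; the default value [0]
   is returned only where the set is empty. *)
Definition resolvent (R : realType) (H : hilbertType R) (lambda : R)
    (B : H -> set H) (x : H) : H :=
  xget 0 (resolvent_set lambda B x).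

(* For a bounded linear [A] the vector [z] below exists and is unique for
   every [y], by the Riesz representation theorem. *)
Definition adjoint (R : realType) (H1 H2 : hilbertType R) (A : H1 -> H2)
    (y : H2) : H1 :=
  xget 0 [set z | forall x : H1, <| A x, y |> = <| x, z |>].

Definition opnorm (R : realType) (V W : normedModType R) (f : V -> W) : R :=
  sup [set `|f x| | x in [set x : V | `|x| <= 1]].

Definition weakly_cvg (R : realType) (V : normedModType R) (x : V^nat)
    (l : V) :=
  forall f : {linear V -> R^o}, continuous f -> f (x k) @[k --> \oo] --> f l.

Definition solution_set (R : realType) (H1 H2 : hilbertType R)
    (B : H1 -> set H1) (F : H2 -> set H2) (A : H1 -> H2) : set H1 :=
  [set x | B x 0 /\ F (A x) 0].

(* Main.v *)
Require Import Defs.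
From HB Require Import structures.
From mathcomp Require Import all_boot all_order all_algebra.
From mathcomp Require Import all_classical all_reals all_analysis.
From mathcomp Require Import ring lra.

(** Along the iteration, for every [z] in the solution set,
    [|x' - z|^2 + |s - x'|^2 + gamma (2 - gamma L) |w|^2 <= |x - z|^2], where
    [w = (I - J^F1) (A x)], [s = x - gamma A^* w] and [x' = J^B1 s]. Hence the
    distances to solutions decrease and both residuals [w] and [s - x'] tend to
    [0]; since graphs of maximal monotone maps are closed for weak-strong
    convergence, weak cluster points are solutions, and Opial's argument
    shows that there is only one of them. Weak cluster points are taken along
    ultrafilters on [nat], where bounded sequences converge weakly.

    Both the Riesz theorem and the surjectivity theorem of Minty follow from
    the existence of a minimizer of a convex function plus half the squared
    norm; for Minty this function is the Fitzpatrick function. *)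

Set Implicit Arguments.
Unset Strict Implicit.
Unset Printing Implicit Defensive.

Import Order.TTheory GRing.Theory Num.Theory.
Import numFieldNormedType.Exports.

Local Open Scope classical_set_scope.
Local Open Scope ring_scope.

(** * Inner products *)

Section InnerProduct.
Variables (R : realType) (H : hilbertType R).
Implicit Types (x y z : H) (a : R).

Lemma innerC x y : <| x, y |> = <| y, x |>.
Proof. by rewrite hermC expr0 mul1r. Qed.

Lemma innerDl x y z : <| x + y, z |> = <| x, z |> + <| y, z |>.
Proof. exact: linearDl. Qed.

Lemma innerDr x y z : <| z, x + y |> = <| z, x |> + <| z, y |>.
Proof. exact: linearDr. Qed.

Lemma innerNl x z : <| - x, z |> = - <| x, z |>.
Proof. exact: linearNl. Qed.

Lemma innerNr x z : <| z, - x |> = - <| z, x |>.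
Proof. exact: linearNr. Qed.

Lemma innerZl a x z : <| a *: x, z |> = a * <| x, z |>.
Proof. exact: linearZl_LR. Qed.

Lemma innerZr a x z : <| z, a *: x |> = a * <| z, x |>.
Proof. by rewrite innerC innerZl innerC. Qed.

Lemma inner0l z : <| 0, z |> = 0 :> R.
Proof. by rewrite -(scale0r z) innerZl mul0r. Qed.

Lemma inner0r z : <| z, 0 |> = 0 :> R.
Proof. by rewrite innerC inner0l. Qed.

Definition innerE :=
  (innerDl, innerDr, innerNl, innerNr, innerZl, innerZr, inner0l, inner0r).

Lemma inner_ge0 x : 0 <= <| x, x |> :> R.
Proof. by rewrite -norm_inner sqr_ge0. Qed.

Lemma inner_eq0 x : <| x, x |> = 0 :> R -> x = 0.
Proof. by rewrite -norm_inner => /eqP; rewrite sqrf_eq0 normr_eq0 => /eqP. Qed.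

(** For nonzero vectors, divide by [|x| |y|] in [0 <= | |y| x - |x| y |^2 = 2 |x| |y| (|x| |y| - <x,
    y>)]. *)
Lemma ler_inner_norm x y : <| x, y |> <= `|x| * `|y|.
Proof.
have := inner_ge0 (`|y| *: x - `|x| *: y).
rewrite !innerE (innerC y x) -!norm_inner.
have [->|x0] := eqVneq x 0; first by rewrite inner0l mulr_ge0.
have [->|y0] := eqVneq y 0; first by rewrite inner0r mulr_ge0.
have xy : 0 < `|x| * `|y| by rewrite mulr_gt0 ?normr_gt0.
move=> h; rewrite -subr_ge0 -(pmulr_rge0 _ xy).
move: h; rewrite !expr2; lra.
Qed.

Lemma CauchySchwarz_inner x y : `| <| x, y |> | <= `|x| * `|y|.
Proof.
rewrite ler_norml ler_inner_norm andbT lerNl -innerNl.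
by rewrite (le_trans (ler_inner_norm _ _)) // normrN.
Qed.

Lemma cvg_inner {T} (F : set_system T) {FF : Filter F} (f g : T -> H) x y :
  f @ F --> x -> g @ F --> y -> <| f t, g t |> @[t --> F] --> <| x, y |>.
Proof.
(* Polarization reduces continuity of the inner product to that of the norm. *)
have polar x' y' : <| x', y' |> = 4^-1 * (`|x' + y'| ^+ 2 - `|x' - y'| ^+ 2).
  by rewrite !norm_inner !innerE (innerC y' x'); field.
move=> fx gy; rewrite polar; under eq_fun do rewrite polar.
apply: cvgMl_tmp; apply: cvgB; rewrite !expr2; under eq_fun do rewrite expr2.
  by apply: cvgM; apply: cvg_norm; exact: cvgD.
by apply: cvgM; apply: cvg_norm; exact: cvgB.
Qed.

End InnerProduct.

(** * The theorems of Riesz and Minty *)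

Section QuadraticMinimization.
Variables (R : realType) (H : hilbertType R).

Lemma cvgn_of_sqr_dist (x : H^nat) (K : R) :
  (forall n k, `|x n - x k| ^+ 2 <= K * (n.+1%:R^-1 + k.+1%:R^-1)) ->
  cvgn x.
Proof.
move=> hK; apply/cauchy_cvgP; apply: cauchy_exP => e e0.
have K0 : (K * n.+1%:R^-1) @[n --> \oo] --> (0 : R).
  by rewrite -[X in _ --> X](mulr0 K); apply: cvgMl_tmp; exact: cvg_harmonic.
have e2 : 0 < e ^+ 2 / 2 by rewrite divr_gt0 ?exprn_gt0.
have hn : \forall n \near \oo, K * n.+1%:R^-1 < e ^+ 2 / 2.
  exact: (cvgr_lt 0 K0).
have [n nP] := filter_ex hn; exists (x n).
apply: filterS hn => k kP /=.
rewrite -ball_normE /ball_ /= -(@ltr_pXn2r _ 2) ?nnegrE ?(ltW e0) //.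
by apply: le_lt_trans (hK n k) _; rewrite mulrDr [ltRHS]splitr ltrD.
Qed.

(** [C] is to be read as the epigraph of a closed convex function of a pair, possibly taking
    infinite values. The conclusion is the first-order optimality condition at the minimizer of this
    function plus half the squared norm; strong convexity makes minimizing sequences Cauchy. *)
Lemma quadratic_minimizer (C : H -> H -> R -> Prop) (m : R) :
  (exists x u t, C x u t) ->
  (forall x u t y v s (a : R), C x u t -> C y v s -> 0 <= a <= 1 ->
    C (x + a *: (y - x)) (u + a *: (v - u)) (t + a * (s - t))) ->
  (forall (x u : H^nat) (t : R^nat) x0 u0 (t0 : R),
    (forall n, C (x n) (u n) (t n)) ->
    x @ \oo --> x0 -> u @ \oo --> u0 -> t @ \oo --> t0 -> C x0 u0 t0) ->
  (forall x u t, C x u t -> m <= t + (<| x, x |> + <| u, u |>) / 2) ->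
  exists x u t, C x u t /\
    forall y v s, C y v s -> t <= s + <| x, y - x |> + <| u, v - u |>.
Proof.
move=> [x1 [u1 [t1 C1]]] Cconvex Cclosed Cm.
pose V (x u : H) (t : R) := t + (<| x, x |> + <| u, u |>) / 2.
pose S : set R := [set r | exists x u t, C x u t /\ r = V x u t].
have Sinf : has_inf S.
  split; first by exists (V x1 u1 t1), x1, u1, t1.
  by exists m => _ [x [u [t [Cx ->]]]]; exact: Cm.
have infV x u t : C x u t -> inf S <= V x u t.
  by move=> Cx; apply: (ge_inf Sinf.2); exists x, u, t.
have /choice[w Pw] : forall n, exists w : H * H * R,
    C w.1.1 w.1.2 w.2 /\ V w.1.1 w.1.2 w.2 < inf S + n.+1%:R^-1.
  move=> n; have n0 : 0 < (n.+1%:R^-1 : R) by rewrite invr_gt0.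
  have [_ [x [u [t [Cx ->]]]] lt] := inf_adherent n0 Sinf.
  by exists (x, u, t).
have dist n k : `|(w n).1.1 - (w k).1.1| ^+ 2 + `|(w n).1.2 - (w k).1.2| ^+ 2
    <= 4 * (n.+1%:R^-1 + k.+1%:R^-1).
  move: (Pw n) (Pw k); move: n.+1%:R^-1 k.+1%:R^-1 => dn dk.
  move: (w n) (w k) => [[x u] t] [[y v] s] /=.
  move=> [Cx Vx] [Cy Vy].
  (* At the midpoint, [V] is the mean of the two values minus one eighth of the squared distance,
     and it is still at least [inf S]; hence the constant 4. *)
  have h : 0 <= (2^-1 : R) <= 1 by apply/andP; split; lra.
  have := infV _ _ _ (Cconvex _ _ _ _ _ _ _ Cx Cy h).
  move: Vx Vy; rewrite /V !norm_inner !innerE (innerC y x) (innerC v u).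
  lra.
have cx : cvgn (fun n => (w n).1.1).
  apply: (@cvgn_of_sqr_dist _ 4) => n k; apply: le_trans (dist n k).
  by rewrite lerDl sqr_ge0.
have cu : cvgn (fun n => (w n).1.2).
  apply: (@cvgn_of_sqr_dist _ 4) => n k; apply: le_trans (dist n k).
  by rewrite lerDr sqr_ge0.
move: cx cu => /cvg_ex[x xP] /cvg_ex[u uP].
have VP : V (w n).1.1 (w n).1.2 (w n).2 @[n --> \oo] --> inf S.
  apply: (@squeeze_cvgr _ _ _ _ (cst (inf S)) (fun n => inf S + n.+1%:R^-1)).
  - by apply: nearW => n; rewrite infV ?(ltW (Pw n).2) //; exact: (Pw n).1.
  - exact: cvg_cst.
  - rewrite -[X in _ --> X]addr0; apply: cvgD; first exact: cvg_cst.
    exact: cvg_harmonic.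
pose t := inf S - (<| x, x |> + <| u, u |>) / 2.
have tP : (w n).2 @[n --> \oo] --> t.
  have -> : (fun n => (w n).2) = (fun n => V (w n).1.1 (w n).1.2 (w n).2 -
     (<| (w n).1.1, (w n).1.1 |> + <| (w n).1.2, (w n).1.2 |>) / 2).
    by apply/funext => n; rewrite /V addrK.
  by apply: cvgB => //; apply: cvgMr_tmp; apply: cvgD; exact: cvg_inner.
have Cx : C x u t by apply: Cclosed xP uP tP => n; exact: (Pw n).1.
exists x, u, t; split=> // y v s Cy; rewrite leNgt; apply/negP => lt.
pose E := s + <| x, y - x |> + <| u, v - u |> - t.
pose D : R := <| y - x, y - x |> + <| v - u, v - u |>.
have E0 : E < 0 by rewrite /E subr_lt0.
have D0 : 0 <= D by rewrite addr_ge0 ?inner_ge0.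
(* [a] makes the increment [a * E + a ^ 2 * D / 2] of [V] negative. *)
pose a := - E / (D - E).
have a0 : 0 < a by rewrite divr_gt0 //; lra.
have a1 : a <= 1 by rewrite ler_pdivrMr; lra.
have a01 : 0 <= a <= 1 by rewrite (ltW a0) a1.
have := infV _ _ _ (Cconvex _ _ _ _ _ _ _ Cx Cy a01).
have -> : V (x + a *: (y - x)) (u + a *: (v - u)) (t + a * (s - t)) =
    inf S + a * (E + a * D / 2).
  by rewrite /V /t /E /D !innerE (innerC y x) (innerC v u) /t; field.
rewrite lerDl pmulr_rge0 // leNgt => /negP; apply.
have -> : E + a * D / 2 = E * (D - 2 * E) / (2 * (D - E)).
  by rewrite /a; field; rewrite gt_eqF //; lra.
by rewrite pmulr_llt0 ?invr_gt0; [rewrite nmulr_rlt0 //; lra|lra].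
Qed.

End QuadraticMinimization.

Section RieszMinty.
Variables (R : realType) (H : hilbertType R).

(** Take for [z] the minimizer of [|x|^2 / 2 - f x]; the second component of the pair is a dummy.
    Optimality tested at [z + x] gives [f x <= <x, z>], and replacing [x] by [- x] gives
    equality. *)
Lemma riesz_representation (f : H -> R) (M : R) :
  scalar f -> (forall x, `|f x| <= M * `|x|) ->
  exists z, forall x, f x = <| x, z |>.
Proof.
move=> flin fM.
have fD x y : f (x + y) = f x + f y.
  by have := flin 1 x y; rewrite scale1r mul1r.
have f0 : f 0 = 0 by apply: (addrI (f 0)); rewrite -fD !addr0.
have fZ a x : f (a *: x) = a * f x by have := flin a x 0; rewrite f0 !addr0.
have fB x y : f (x - y) = f x - f y by rewrite fD -scaleN1r fZ mulN1r.
have [] := @quadratic_minimizer R H (fun x _ t => - f x <= t) (- (M ^+ 2 / 2)).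
- by exists 0, 0, (- f 0).
- move=> x _ t y _ s a tx sy /andP[a0 a1]; rewrite fD fZ fB.
  have := ler_wpM2l a0 sy.
  have : 0 <= 1 - a by lra.
  by move=> b0 h1; have := ler_wpM2l b0 tx; lra.
- move=> x _ t x0 _ t0 tx xx0 _ tt0.
  have fc : f (x n) @[n --> \oo] --> f x0.
    apply/subr_cvg0/norm_cvg0P.
    apply: (@squeeze_cvgr _ _ _ _ (cst 0) (fun n => M * `|x n - x0|)).
    + by apply: nearW => n; rewrite normr_ge0 -fB fM.
    + exact: cvg_cst.
    + rewrite -[X in _ --> X](mulr0 M); apply: cvgMl_tmp.
      by apply/norm_cvg0P/subr_cvg0.
  rewrite -subr_ge0; apply: (cvgr_to_ge (cvgB tt0 (cvgN fc))).
  by apply: nearW => n; rewrite !fctE subr_ge0.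
- move=> x u t tx; have := fM x; rewrite ler_norml => /andP[_ fx].
  have := sqr_ge0 (M - `|x|); rewrite sqrrB norm_inner.
  have := inner_ge0 u; rewrite mulr2n; lra.
move=> z [u [t [zt zmin]]]; exists z.
have le x : f x <= <| x, z |>.
  have := zmin (z + x) u (- f (z + x)) (lexx _).
  by rewrite (addrC z) addrK subrr inner0r fD (innerC z); lra.
move=> x; apply/eqP; rewrite eq_le le /=.
by have := le (- x); rewrite -scaleN1r fZ innerZl; lra.
Qed.

(** Otherwise, adding the pair [(x, u)] to the graph of [B] would give a proper monotone
    extension. *)
Lemma maximal_monotone_mem (B : H -> set H) x u : maximal_monotone B ->
  (forall y v, B y v -> 0 <= <| u - v, x - y |>) -> B x u.
Proof.
move=> [Bmon Bmax] xu.
pose C y : set H := [set v | B y v \/ (y = x /\ v = u)].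
apply: contrapT => nBxu; apply: (Bmax C); last first.
  split; first by move=> [y v] /=; left.
  by move=> /(_ (x, u)) /= /(_ (or_intror (conj erefl erefl))).
move=> y y' v v' [By|[-> ->]] [By'|[-> ->]]; first exact: Bmon.
- by have := xu _ _ By; rewrite -(opprB u) -(opprB x) innerNl innerNr opprK.
- exact: xu.
- by rewrite subrr inner0l.
Qed.

(* The set [C] below is the epigraph of the Fitzpatrick function of [G], which
   is convex, dominates the duality product by maximality, and agrees with it
   on [G]. *)
Lemma minty_surjective (G : H -> set H) :
  monotone_map G ->
  (forall x u, (forall y v, G y v -> 0 <= <| u - v, x - y |>) -> G x u) ->
  exists z, G z (- z).
Proof.
move=> Gmon Gmax.
pose C (x u : H) (t : R) :=
  forall y v, G y v -> <| x, v |> + <| y, u |> - <| y, v |> <= t.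
have CG y v : G y v -> C y v <| y, v |>.
  move=> Gyv y' v' Gyv'; have := Gmon _ _ _ _ Gyv Gyv'.
  by rewrite !innerE !(innerC _ y) !(innerC _ y'); lra.
have Cdual x u t : C x u t -> <| x, u |> <= t.
  move=> Cx; have [//|lt] := leP (<| x, u |>) t.
  suff Gxu : G x u by have := Cx _ _ Gxu; lra.
  apply: Gmax => y v /Cx.
  by rewrite !innerE !(innerC _ x) !(innerC _ y); lra.
have [] := @quadratic_minimizer R H C 0.
- have [[y [v Gyv]]|nG] := pselect (exists y v, G y v).
    by exists y, v, <| y, v |>; exact: CG.
  have G0 : G 0 0 by apply: Gmax => y v Gyv; case: nG; exists y, v.
  by exists 0, 0, <| (0 : H), 0 |>; exact: CG.
- move=> x u t y v s a Cx Cy /andP[a0 a1] y' v' Gy'.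
  have := ler_wpM2l a0 (Cy _ _ Gy').
  have : 0 <= 1 - a by lra.
  move=> b0 h1; have := ler_wpM2l b0 (Cx _ _ Gy').
  by move: h1; rewrite !innerE; lra.
- move=> x u t x0 u0 t0 Cn xx0 uu0 tt0 y v Gyv.
  have lim : <| x n, v |> + <| y, u n |> - <| y, v |> @[n --> \oo] -->
      <| x0, v |> + <| y, u0 |> - <| y, v |>.
    apply: cvgB; last exact: cvg_cst.
    by apply: cvgD; apply: cvg_inner => //; exact: cvg_cst.
  rewrite -subr_ge0; apply: (cvgr_to_ge (cvgB tt0 lim)).
  by apply: nearW => n; rewrite !fctE subr_ge0; exact: Cn.
- move=> x u t /Cdual; have := inner_ge0 (x + u).
  by rewrite !innerE (innerC u); lra.
move=> x [u [t [Cx xmin]]].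
(* This is optimality tested at [(y, v)], combined with [<x, u> <= t]. It shows that [(- u, - x)] is
   monotonically related to [G], hence lies in it; taking this pair for [(y, v)] then forces
   [x + u = 0]. *)
have key y v : G y v -> <| x + u, x + u |> <= <| - x - v, - u - y |>.
  move=> Gyv; have := xmin _ _ _ (CG _ _ Gyv); have := Cdual _ _ _ Cx.
  by rewrite !innerE !(innerC _ x) !(innerC _ y) !(innerC _ u); lra.
have Gux : G (- u) (- x).
  by apply: Gmax => y v /key; apply: le_trans; exact: inner_ge0.
have /eqP : <| x + u, x + u |> = 0 :> R.
  apply/eqP; rewrite eq_le inner_ge0 andbT.
  by apply: le_trans (key _ _ Gux) _; rewrite !subrr inner0r.
move=> /eqP /inner_eq0 /eqP; rewrite addr_eq0 => /eqP xu.
by exists (- u); move: Gux; rewrite -xu.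
Qed.

End RieszMinty.

(** * Resolvents and adjoints *)

Lemma ler_of_sqr_le (R : realDomainType) (a t : R) :
  0 <= a -> 0 <= t -> t * t <= a * t -> t <= a.
Proof. by move=> a0; rewrite le0r => /predU1P[->//|t0]; rewrite ler_pM2r. Qed.

Lemma resolventP (R : realType) (H : hilbertType R) (B : H -> set H)
    (lambda : R) (x : H) : maximal_monotone B -> 0 < lambda ->
  B (resolvent lambda B x) (lambda^-1 *: (x - resolvent lambda B x)).
Proof.
move=> Bmax l0; have li0 : 0 < lambda^-1 by rewrite invr_gt0.
(* Minty's theorem is applied to [B] scaled by [lambda] and shifted by [x]. The point found shows
   that the resolvent set is nonempty, so that [xget] does not return its default value. *)
have [z] : exists z, B z (lambda^-1 *: (- z + x)).
  apply: (@minty_surjective R H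
    (fun z => [set p | B z (lambda^-1 *: (p + x))])).
    move=> y y' p p' By By'; have := Bmax.1 _ _ _ _ By By'.
    by rewrite -scalerBr innerZl pmulr_rge0 // opprD addrACA subrr addr0.
  move=> y p yp; apply: maximal_monotone_mem => // y' u By'.
  have := yp y' (lambda *: u - x).
  rewrite /= subrK scalerA mulVf ?gt_eqF // scale1r => /(_ By').
  rewrite -(pmulr_rge0 _ li0) -innerZl.
  by rewrite opprB addrA scalerBr scalerA mulVf ?gt_eqF // scale1r.
rewrite addrC => Bz.
have [u Bu xu] : resolvent_set lambda B x (resolvent lambda B x).
  apply: xgetPex; exists z, (lambda^-1 *: (x - z)) => //.
  by rewrite scalerA mulfV ?gt_eqF // scale1r addrC subrK.
have -> // : lambda^-1 *: (x - resolvent lambda B x) = u.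
by rewrite {1}xu addrAC subrr add0r scalerA mulVf ?gt_eqF // scale1r.
Qed.

Lemma resolvent_zero_ge0 (R : realType) (H : hilbertType R) (B : H -> set H)
    (lambda : R) (x z : H) : maximal_monotone B -> 0 < lambda -> B z 0 ->
  0 <= <| x - resolvent lambda B x, resolvent lambda B x - z |>.
Proof.
move=> Bmax l0 Bz; have := Bmax.1 _ _ _ _ (resolventP x Bmax l0) Bz.
by rewrite subr0 innerZl pmulr_rge0 ?invr_gt0.
Qed.

(** Monotonicity against [(z, 0)] gives [|J x - z|^2 <= <x - z, J x - z>]; Cauchy-Schwarz
    concludes. *)
Lemma ler_norm_resolvent (R : realType) (H : hilbertType R) (B : H -> set H)
    (lambda : R) (x z : H) : maximal_monotone B -> 0 < lambda -> B z 0 ->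
  `|resolvent lambda B x - z| <= `|x - z|.
Proof.
move=> Bmax l0 Bz; apply: ler_of_sqr_le => //; rewrite -expr2.
apply: le_trans (ler_inner_norm _ _); rewrite norm_inner -subr_ge0.
have := resolvent_zero_ge0 x Bmax l0 Bz; congr (_ <= _).
by rewrite -innerNl -innerDl opprB addrA subrK.
Qed.

(** Only homogeneity is assumed, so that the lemma applies to [adjoint A \o A], whose [adjoint A] is
    a plain function. *)
Lemma homogeneous_bound (R : realType) (V W : normedModType R) (f : V -> W)
    (M : R) : (forall a x, f (a *: x) = a *: f x) ->
  (forall x, `|x| <= 1 -> `|f x| <= M) -> forall x, `|f x| <= M * `|x|.
Proof.
move=> fZ fM x; have [->|x0] := eqVneq x 0.
  by rewrite -(scale0r 0) fZ !scale0r !normr0 mulr0.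
have nx : 0 < `|x| by rewrite normr_gt0.
have := fM (`|x|^-1 *: x).
rewrite fZ !normrZ !normfV !normr_id mulVf ?gt_eqF // => /(_ (lexx _)).
by rewrite mulrC ler_pdivrMr.
Qed.

Section Adjoint.
Variables (R : realType) (H1 H2 : hilbertType R) (A : {linear H1 -> H2}).
Hypothesis hA : bounded_fun_norm A.

Lemma bounded_linear_bound :
  exists2 M, 0 <= M & forall x, `|A x| <= M * `|x|.
Proof.
have [M AM] := hA 1; exists `|M| => // x.
apply: le_trans (homogeneous_bound (linearZ_LR A) AM x) _.
by rewrite ler_wpM2r ?ler_norm.
Qed.

Lemma adjointP x y : <| A x, y |> = <| x, adjoint A y |>.
Proof.
have [M M0 AM] := bounded_linear_bound.
suff /xgetPex : exists z, forall x, <| A x, y |> = <| x, z |> by exact.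
apply: (@riesz_representation _ _ _ (M * `|y|)) => [a u v|u].
  by rewrite linearP !innerE.
apply: le_trans (CauchySchwarz_inner _ _) _.
by rewrite mulrAC ler_wpM2r.
Qed.

Lemma adjointZ a y : adjoint A (a *: y) = a *: adjoint A y.
Proof.
apply/eqP; rewrite -subr_eq0; apply/eqP; apply: inner_eq0.
by rewrite innerDr innerNr innerZr -!adjointP innerZr subrr.
Qed.

(** Ensures that the [sup] in [opnorm] is a genuine upper bound rather than a default value. *)
Lemma has_ubound_adjoint_comp :
  has_ubound [set `|(adjoint A \o A) x| | x in [set x | `|x| <= 1]].
Proof.
have [M M0 AM] := bounded_linear_bound.
exists (M * M) => _ [z /= z1 <-].
suff adjM : `|adjoint A (A z)| <= M * `|A z|.
  apply: le_trans adjM _; rewrite ler_wpM2l //.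
  by apply: le_trans (AM z) _; rewrite ler_piMr.
apply: ler_of_sqr_le; rewrite ?mulr_ge0 // -expr2 norm_inner -adjointP.
apply: le_trans (ler_inner_norm _ _) _.
by rewrite mulrAC ler_wpM2r.
Qed.

Lemma opnorm_adjoint_comp_ge0 : 0 <= opnorm (adjoint A \o A).
Proof.
apply: le_trans (normr_ge0 (adjoint A (A 0))) _.
by apply: (ub_le_sup has_ubound_adjoint_comp); exists 0; rewrite //= normr0.
Qed.

Lemma ler_opnorm_adjoint_comp x :
  `|adjoint A (A x)| <= opnorm (adjoint A \o A) * `|x|.
Proof.
apply: (@homogeneous_bound _ _ _ (adjoint A \o A)) => [a y /=|y y1].
  by rewrite linearZ_LR adjointZ.
by apply: (ub_le_sup has_ubound_adjoint_comp); exists y.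
Qed.

(** With [z = adjoint A y], one has [|z|^2 = <A z, y> <= |A z| |y|] and [|A z|^2 = <z, adjoint A (A
    z)> <= L |z|^2]. Squaring the first and cancelling [|z|^2] gives the bound. *)
Lemma sqr_norm_adjoint_le y :
  `|adjoint A y| ^+ 2 <= opnorm (adjoint A \o A) * `|y| ^+ 2.
Proof.
set L := opnorm _; set z := adjoint A y.
have L0 : 0 <= L := opnorm_adjoint_comp_ge0.
have Az : `|A z| ^+ 2 <= L * `|z| ^+ 2.
  rewrite norm_inner adjointP; apply: le_trans (ler_inner_norm _ _) _.
  by rewrite mulrC expr2 mulrA ler_wpM2r // ler_opnorm_adjoint_comp.
have zy : `|z| ^+ 2 <= `|A z| * `|y|.
  by rewrite norm_inner -adjointP ler_inner_norm.
apply: ler_of_sqr_le; rewrite ?mulr_ge0 ?sqr_ge0 // -expr2.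
have := ler_wpM2r (sqr_ge0 `|y|) Az; rewrite [leRHS]mulrAC; apply: le_trans.
by rewrite -exprMn lerXn2r ?nnegrE ?mulr_ge0 ?sqr_ge0.
Qed.

End Adjoint.

(** * Weak convergence *)

(** If [f] missed a neighbourhood [N] along [F], then [F] restricted to the complement of the
    preimage of [N] would be proper, and an ultrafilter above it would contradict the hypothesis. *)
Lemma cvg_ultra (T : Type) (V : topologicalType) (F : set_system T)
    (f : T -> V) (l : V) : ProperFilter F ->
  (forall U, UltraFilter U -> F `<=` U -> f @ U --> l) -> f @ F --> l.
Proof.
move=> FF fU N Nl; apply: contrapT => nFN.
have GF : ProperFilter (within (~` (f @^-1` N)) F).
  apply: Build_ProperFilter_ex.
  move=> P FP; apply: contrapT => nP; apply: nFN.
  have {}FP : F [set t | (~` (f @^-1` N)) t -> P t] := FP.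
  apply: (@filterS _ F _ _ (f @^-1` N) _ FP) => t Pt.
  by apply: contrapT => /Pt ?; apply: nP; exists t.
have [U [UU GU]] := ultraFilterLemma GF.
have FU : F `<=` U by move=> P FP; apply: GU; exact: (@cvg_within _ F).
have UN : U (~` (f @^-1` N)) by apply: GU; exact: withinT.
have UN' : U (f @^-1` N) by exact: fU UU FU N Nl.
have [t [nNt Nt]] := filter_ex (filterI UN UN').
exact: nNt.
Qed.

(** The segment is compact, and an ultrafilter converges to each of its cluster points. *)
Lemma bounded_cvg_ultra (R : realType) (T : Type) (U : set_system T)
    (f : T -> R) (M : R) : UltraFilter U -> (forall t, `|f t| <= M) ->
  cvg (f @ U).
Proof.
move=> UU fM.
have UM : U (f @^-1` `[- M, M]%classic).
  by apply: nearW => t; rewrite /= in_itv /= -ler_norml.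
have [l [_ fl]] := segment_compact (F := f @ U) _ UM.
apply/cvg_ex; exists l => N Nl.
have [//|UN] := in_ultra_setVsetC (f @^-1` N) UU.
by have [y [/= nNy Ny]] := fl (~` N) N UN Nl.
Qed.

Lemma cvg0_of_sqr_norm_le (R : realType) (V : normedModType R) (f : V^nat)
    (g : R^nat) : (forall n, `|f n| ^+ 2 <= g n) -> g @ \oo --> 0 ->
  f @ \oo --> 0.
Proof.
move=> fg g0; apply: norm_cvg0.
have : Num.sqrt (`|f n| ^+ 2) @[n --> \oo] --> Num.sqrt (0 : R).
  apply: continuous_cvg; first exact: sqrt_continuous.
  apply: (@squeeze_cvgr _ _ _ _ (cst 0) g) => //; last exact: cvg_cst.
  by apply: nearW => n; rewrite sqr_ge0 fg.
by rewrite sqrtr0; under eq_fun do rewrite sqrtr_sqr normr_id.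
Qed.

Section WeakConvergence.
Variables (R : realType) (H : hilbertType R).

(** The limits of [<y, x t>] along [U] form a bounded linear functional of [y], represented by [p]
    through Riesz. *)
Lemma bounded_inner_cvg_ultra (T : Type) (U : set_system T) (x : T -> H)
    (M : R) : UltraFilter U -> (forall t, `|x t| <= M) ->
  exists p, forall y, <| x t, y |> @[t --> U] --> <| p, y |>.
Proof.
move=> UU xM; have xyM y t : `| <| y, x t |> | <= M * `|y|.
  by apply: le_trans (CauchySchwarz_inner _ _) _; rewrite mulrC ler_wpM2r.
have /choice[f fP] y : exists l : R, <| y, x t |> @[t --> U] --> l.
  by apply/cvg_ex; exact: bounded_cvg_ultra (xyM y).
have [a u v|y|p pP] := @riesz_representation R H f M.
- apply: (cvg_unique (@Rhausdorff R) (fP _)) => /=.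
  under eq_fun do rewrite innerDl innerZl.
  by apply: cvgD => //; exact: cvgMl_tmp.
- by apply: (cvgr_to_le (cvg_norm (fP y))); exact: nearW (xyM y).
exists p => y; rewrite innerC -pP.
by under eq_fun do rewrite innerC; exact: fP.
Qed.

(** Pass to the limit in [0 <= <u t - v, x t - y>]: boundedness of [x] kills the term in [u t], and
    the rest is linear in [x t]. *)
Lemma maximal_monotone_demiclosed (T : Type) (F : set_system T)
    (B : H -> set H) (x u : T -> H) (p : H) (M : R) : ProperFilter F ->
  maximal_monotone B -> (forall t, `|x t| <= M) ->
  (forall t, B (x t) (u t)) -> u @ F --> 0 ->
  (forall y, <| x t, y |> @[t --> F] --> <| p, y |>) -> B p 0.
Proof.
move=> FF Bmax xM Bxu u0 xp; apply: maximal_monotone_mem => // y v Byv.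
have ux : <| u t, x t - y |> @[t --> F] --> (0 : R).
  apply: norm_cvg0.
  apply: (@squeeze_cvgr _ _ _ _ (cst 0) (fun t => `|u t| * (M + `|y|))).
  - apply: nearW => t; rewrite normr_ge0 /=.
    apply: le_trans (CauchySchwarz_inner _ _) _; rewrite ler_wpM2l //.
    by apply: le_trans (ler_normB _ _) _; rewrite lerD2r.
  - exact: cvg_cst.
  - rewrite -[X in _ --> X](mul0r (M + `|y|)); apply: cvgMr_tmp.
    exact/norm_cvg0P.
have lim : <| u t, x t - y |> - (<| x t, v |> - <| y, v |>) @[t --> F] -->
    0 - (<| p, v |> - <| y, v |>).
  by apply: cvgB => //; apply: cvgB => //; exact: cvg_cst.
have -> : <| 0 - v, p - y |> = 0 - (<| p, v |> - <| y, v |>) :> R.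
  by rewrite !innerE (innerC v p) (innerC v y); lra.
apply: (cvgr_to_ge lim); apply: nearW => t.
have := Bmax.1 _ _ _ _ (Bxu t) Byv.
by rewrite innerDl innerNl (innerC v) innerDl innerNl.
Qed.

Lemma weakly_cvg_inner (x : H^nat) p :
  (forall y, <| x n, y |> @[n --> \oo] --> <| p, y |>) -> weakly_cvg x p.
Proof.
move=> xp f fc.
have /linear_bounded_continuous /linear_boundedP /filter_ex[M fM] := fc.
have [z fz] := riesz_representation (fun a u v => linearP f a u v) fM.
by rewrite fz; under eq_fun do rewrite fz; exact: xp.
Qed.

Lemma fejer_sqr_dist_cvgn (x : H^nat) z :
  (forall n, `|x n.+1 - z| <= `|x n - z|) -> cvgn (fun n => `|x n - z| ^+ 2).
Proof.
move=> xz; apply: nonincreasing_is_cvgn.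
  apply/nonincreasing_seqP => n.
  by rewrite lerXn2r ?nnegrE.
by exists 0 => _ [n _ <-]; exact: sqr_ge0.
Qed.

Lemma fejer_bounded (x : H^nat) z :
  (forall n, `|x n.+1 - z| <= `|x n - z|) ->
  forall n, `|x n| <= `|x 0%N - z| + `|z|.
Proof.
move=> xz n; rewrite -{1}(subrK z (x n)); apply: le_trans (ler_normD _ _) _.
rewrite lerD2r; elim: n => // n; exact: le_trans.
Qed.

(** One ultrafilter finer than [\oo] provides [p]. Every other one has a weak limit too, equal to
    [p] by uniqueness, so [cvg_ultra] gives convergence along [\oo] itself. *)
Lemma opial (x : H^nat) (S : set H) : S !=set0 ->
  (forall z n, S z -> `|x n.+1 - z| <= `|x n - z|) ->
  (forall U p, UltraFilter U -> \oo `<=` U ->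
    (forall y, <| x n, y |> @[n --> U] --> <| p, y |>) -> S p) ->
  exists2 p, S p & weakly_cvg x p.
Proof.
move=> [z0 Sz0] xS clust.
have xM := fejer_bounded (fun n => xS z0 n Sz0).
(* Two weak cluster points coincide: [<x n, p - q>] has a limit, since it is an
   affine combination of the convergent squared distances to [p] and [q]. *)
have uniq U V p q : UltraFilter U -> UltraFilter V ->
    \oo `<=` U -> \oo `<=` V ->
    (forall y, <| x n, y |> @[n --> U] --> <| p, y |>) ->
    (forall y, <| x n, y |> @[n --> V] --> <| q, y |>) -> p = q.
  move=> UU UV oU oV xp xq.
  have Sp : S p := clust _ _ UU oU xp.
  have Sq : S q := clust _ _ UV oV xq.
  have [l xl] : exists l : R, <| x n, p - q |> @[n --> \oo] --> l.
    apply/cvg_ex.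
    have -> : (fun n => <| x n, p - q |>) = (fun n =>
        (`|x n - q| ^+ 2 - `|x n - p| ^+ 2 + (`|p| ^+ 2 - `|q| ^+ 2)) / 2 : R).
      apply/funext => n; rewrite !norm_inner !innerE !(innerC _ (x n)).
      by field.
    apply: is_cvgMr_tmp; apply: is_cvgD; last exact: is_cvg_cst.
    by apply: is_cvgB; apply: fejer_sqr_dist_cvgn => n; exact: xS.
  have pl : <| p, p - q |> = l.
    apply: (cvg_unique (@Rhausdorff R) (xp _)) => N /xl.
    exact: oU.
  have ql : <| q, p - q |> = l.
    apply: (cvg_unique (@Rhausdorff R) (xq _)) => N /xl.
    exact: oV.
  apply/eqP; rewrite -subr_eq0; apply/eqP; apply: inner_eq0.
  by rewrite innerDl innerNl pl ql subrr.
have [U [UU oU]] := ultraFilterLemma (F := \oo) _.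
have [p xp] := bounded_inner_cvg_ultra UU xM.
exists p; first exact: clust UU oU xp.
apply: weakly_cvg_inner => y; apply: cvg_ultra => V UV oV.
have [q xq] := bounded_inner_cvg_ultra UV xM.
by rewrite (uniq _ _ _ _ UU UV oU oV xp xq).
Qed.

End WeakConvergence.

(** * The iteration *)

(** Monotonicity of [B1] at [z] handles the step from [s] to [x']. Monotonicity of [F1] at [A z]
    gives [|w|^2 <= <x - z, adjoint A w>], which outweighs the quadratic term [gamma^2 |adjoint A
    w|^2 <= gamma^2 L |w|^2] in the expansion of [|s - z|^2]. *)
Lemma split_forward_backward_fejer (R : realType) (H1 H2 : hilbertType R)
    (B1 : H1 -> set H1) (F1 : H2 -> set H2) (A : {linear H1 -> H2})
    (lambda gamma : R) (x z : H1) :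
  let w := A x - resolvent lambda F1 (A x) in
  let s := x - gamma *: adjoint A w in
  let x' := resolvent lambda B1 s in
  maximal_monotone B1 -> maximal_monotone F1 -> bounded_fun_norm A ->
  0 < lambda -> 0 <= gamma -> solution_set B1 F1 A z ->
  `|x' - z| ^+ 2 + `|s - x'| ^+ 2
    + gamma * (2 - gamma * opnorm (adjoint A \o A)) * `|w| ^+ 2
  <= `|x - z| ^+ 2.
Proof.
move=> w s x' hB1 hF1 hA l0 g0 [Bz Fz].
have sx : 0 <= <| s - x', x' - z |> := resolvent_zero_ge0 s hB1 l0 Bz.
have wx : 0 <= <| w, A x - w - A z |>.
  by rewrite subKr; exact: resolvent_zero_ge0.
have sE : s = x - gamma *: adjoint A w by [].
clearbody x' s w.
have backward : `|x' - z| ^+ 2 + `|s - x'| ^+ 2 <= `|s - z| ^+ 2.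
  move: sx; rewrite !norm_inner !innerE.
  by rewrite !(innerC _ z) !(innerC _ x'); lra.
have wxz : `|w| ^+ 2 <= <| x - z, adjoint A w |>.
  move: wx; rewrite -adjointP // (raddfB A) norm_inner !innerE !(innerC _ w).
  lra.
have forward : `|s - z| ^+ 2 = `|x - z| ^+ 2
    - gamma * (2 * <| x - z, adjoint A w |> - gamma * `|adjoint A w| ^+ 2).
  by rewrite sE !norm_inner !innerE !(innerC z) !(innerC (adjoint A w)); ring.
have := ler_wpM2l g0 wxz.
have := ler_wpM2l (mulr_ge0 g0 g0) (sqr_norm_adjoint_le hA w).
move: backward forward; lra.
Qed.

(* With [L%:E^-1 = +oo] when [L = 0], the condition [gamma < 2 / L] in [\bar R]
   also covers the degenerate case [L = 0]. *)
Theorem theorem3p2 (R : realType) (H1 H2 : hilbertType R)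
    (B1 : H1 -> set H1) (F1 : H2 -> set H2)
    (hB1 : maximal_monotone B1) (hF1 : maximal_monotone F1)
    (A : {linear H1 -> H2}) (hA : bounded_fun_norm A)
    (L : R) (hL : L = opnorm (adjoint A \o A))
    (lambda : R) (hlambda : 0 < lambda)
    (hGamma : solution_set B1 F1 A !=set0)
    (gamma : R) (gamma_gt0 : 0 < gamma)
    (gamma_lt : (gamma%:E < 2%:E / L%:E)%E)
    (x0 : H1) (x : H1^nat) (hx0 : x 0%N = x0)
    (hx : forall k : nat, x k.+1 =
      resolvent lambda B1
        (x k - gamma *: adjoint A (A (x k) - resolvent lambda F1 (A (x k))))) :
  exists2 xstar : H1, solution_set B1 F1 A xstar & weakly_cvg x xstar.

Proof.
have [z0 Sz0] := hGamma.
have gL : gamma * L < 2.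
  have := opnorm_adjoint_comp_ge0 hA; rewrite -hL le0r => /predU1P[->|L0].
    by rewrite mulr0.
  by move: gamma_lt; rewrite inver gt_eqF // -EFinM lte_fin ltr_pdivlMr.
pose w k := A (x k) - resolvent lambda F1 (A (x k)).
pose s k := x k - gamma *: adjoint A (w k).
pose c := gamma * (2 - gamma * L).
have c0 : 0 < c by rewrite mulr_gt0 ?subr_gt0.
have descent z k : solution_set B1 F1 A z ->
    `|x k.+1 - z| ^+ 2 + `|s k - x k.+1| ^+ 2 + c * `|w k| ^+ 2
    <= `|x k - z| ^+ 2.
  move=> Sz; rewrite hx /c hL.
  by apply: (split_forward_backward_fejer (x k) hB1) => //; exact: ltW.
have fejer z k : solution_set B1 F1 A z -> `|x k.+1 - z| <= `|x k - z|.
  move=> Sz; rewrite -(@ler_pXn2r _ 2) ?nnegrE //.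
  apply: le_trans (descent z k Sz); rewrite -addrA lerDl.
  by rewrite addr_ge0 ?sqr_ge0 // mulr_ge0 ?sqr_ge0 // ltW.
have xz0 k := fejer z0 k Sz0.
(* The squared distances converge, so their decrements vanish; by [descent] these dominate both
   squared residuals. *)
have D0 : `|x k - z0| ^+ 2 - `|x k.+1 - z0| ^+ 2 @[k --> \oo] --> (0 : R).
  have /cvg_ex[l xl] := fejer_sqr_dist_cvgn xz0.
  rewrite -(subrr l); apply: cvgB => //.
  by rewrite (cvg_shiftS (fun k => `|x k - z0| ^+ 2)).
have s0 : s k - x k.+1 @[k --> \oo] --> 0.
  apply: cvg0_of_sqr_norm_le D0 => k; have := descent z0 k Sz0.
  by have := mulr_ge0 (ltW c0) (sqr_ge0 `|w k|); lra.
have w0 : w k @[k --> \oo] --> 0.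
  apply: (@cvg0_of_sqr_norm_le _ _ _
    (fun k => c^-1 * (`|x k - z0| ^+ 2 - `|x k.+1 - z0| ^+ 2))) => [k|].
    rewrite mulrC ler_pdivlMr //; have := descent z0 k Sz0.
    by have := sqr_ge0 `|s k - x k.+1|; lra.
  by rewrite -[X in _ --> X](mulr0 c^-1); exact: cvgMl_tmp.
have xM := fejer_bounded xz0.
apply: opial => // U p UU oU xp.
have {}s0 : s k - x k.+1 @[k --> U] --> 0 by move=> N /s0; exact: oU.
have {}w0 : w k @[k --> U] --> 0 by move=> N /w0; exact: oU.
split.
- apply: (@maximal_monotone_demiclosed _ _ _ U B1 (fun k => x k.+1)
    (fun k => lambda^-1 *: (s k - x k.+1)) _ _ _ hB1 (fun k => xM k.+1)).
  + by move=> k; rewrite hx; exact: resolventP.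
  + rewrite -[X in _ --> X](scaler0 _ lambda^-1).
    by apply: cvgZ => //; exact: cvg_cst.
  + move=> y.
    (* [U] need not be invariant under the shift, so the weak limit of [x k.+1] is obtained from
       that of [x k] by subtracting two strongly vanishing terms. *)
    have -> : (fun k => <| x k.+1, y |>) =
        (fun k => <| x k, y |> - gamma * <| w k, A y |>
                  - <| s k - x k.+1, y |>).
      apply/funext => k; rewrite innerDl innerNl /s innerDl innerNl innerZl.
      by rewrite (innerC (w k)) adjointP // (innerC y); ring.
    have -> : <| p, y |> = <| p, y |> - gamma * <| 0, A y |> - <| 0, y |> :> R.
      by rewrite !inner0l mulr0 !subr0.
    by apply: cvgB; [apply: cvgB => //; apply: cvgMl_tmp|];
      apply: cvg_inner => //; exact: cvg_cst.
- have [M M0 AM] := bounded_linear_bound hA.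
  (* The points [A (x k) - w k] are the resolvents of [A (x k)]. They lie within
     [|A (x k - z0)| <= M |x 0 - z0|] of [A z0], which explains the bound. *)
  apply: (@maximal_monotone_demiclosed _ _ _ U F1 (fun k => A (x k) - w k)
    (fun k => lambda^-1 *: w k) _ (M * `|x 0%N - z0| + `|A z0|) _ hF1).
  + move=> k; rewrite /w subKr.
    rewrite -(subrK (A z0) (resolvent _ _ _)).
    apply: le_trans (ler_normD _ _) _; rewrite lerD2r.
    apply: le_trans (ler_norm_resolvent _ hF1 hlambda Sz0.2) _.
    rewrite -raddfB; apply: le_trans (AM _) _; rewrite ler_wpM2l //.
    by elim: k => // k; exact: le_trans.
  + by move=> k; rewrite /w subKr; exact: resolventP.
  + rewrite -[X in _ --> X](scaler0 _ lambda^-1).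
    by apply: cvgZ => //; exact: cvg_cst.
  + move=> y; rewrite -[X in _ --> X]subr0 -(inner0l y).
    under eq_fun do rewrite innerDl innerNl.
    apply: cvgB; last by apply: cvg_inner => //; exact: cvg_cst.
    by rewrite adjointP //; under eq_fun do rewrite adjointP //; exact: xp.
Qed.
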